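(* Let $p>0$ be a prime. The ring $R_\infty\otimes\mathbb{Q}$ is isomorphic to the subring of $\prod_{i=0}^\infty\mathbb{Q}$ whose elements are the almost constant sequences $(a_0,a_1,\ldots)$.
   Context: A sequence of rational numbers $(a_0,a_1,\ldots)$ is called almost constant if $a_i=a_{i+1}=\ldots$ for some index $i\geq 0$. The convolution ring $R$ in characteristic $p$: let $k$ be a field of characteristic $p$ and consider the category of pairs $(V,\varphi)$, where $V$ is a finite-dimensional $k$-vector space and $\varphi$ is a nilpotent endomorphism. $R$ is the free abelian group on isomorphism classes of such pairs modulo the relations $[V]=[V']+[V'']$ coming from direct sum decompositions. As an abelian group it is free on the classes $f_n$, $n\geq 1$, of $k^n$ with the nilpotent Jordan block $J_n$ of size $n$. Multiplication is induced by sending $(V,\varphi),(V',\varphi')$ to $V\otimes_k V'$ with the endomorphism $\varphi\otimes\mathrm{id}+\mathrm{id}\otimes\varphi'$; the unit is $f_1=1$ and $R$ depends only on $p$. For $\nu\geq 0$, $R_\nu\subset R$ is the subgroup generated by $f_1,f_p,\ldots,f_{p^\nu}$, which is a subring, and $R_\infty=\bigcup_{\nu\geq 0}R_\nu\subset R$. *)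

(* Defs.v *)
From HB Require Import structures.
From mathcomp Require Import all_boot all_algebra generic_quotient ring_quotient.
From mathcomp Require Import boolp functions.
From mathcomp Require Import mxtens.
From mathcomp Require Import freeg.

Set Implicit Arguments.
Unset Strict Implicit.
Unset Printing Implicit Defensive.

Import GRing.Theory.
Local Open Scope ring_scope.
Local Open Scope quotient_scope.

Section GeneratedSubgroup.
Variables (G : zmodType) (S : G -> Prop).

Inductive generated : G -> Prop :=
| generated0 : generated 0
| generatedB x y : generated x -> generated y -> generated (x - y)
| generated_mem x : S x -> generated x.

Definition gen_subgroup : {pred G} := fun x => `[< generated x >].

Lemma gen_subgroupP x : reflect (generated x) (x \in gen_subgroup).
Proof. exact: asboolP. Qed.

Fact gen_subgroup_zmod : zmod_closed gen_subgroup.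
Proof.
split=> [|x y /gen_subgroupP Hx /gen_subgroupP Hy]; apply/gen_subgroupP.
  exact: generated0.
exact: generatedB.
Qed.
HB.instance Definition _ :=
  GRing.isZmodClosed.Build G gen_subgroup gen_subgroup_zmod.

End GeneratedSubgroup.

Section FreeAbelian.
Variables (K : choiceType) (Z : zmodType).

Definition fab_lift (f : K -> Z) (x : {freeg K}) : Z :=
  fglift (f : K -> zmodule Z) x.

Fact fab_lift_is_zmod_morphism f : zmod_morphism (fab_lift f).
Proof. exact: (@lift_is_additive _ _ (zmodule Z)). Qed.
HB.instance Definition _ f :=
  GRing.isZmodMorphism.Build {freeg K} Z (fab_lift f)
    (fab_lift_is_zmod_morphism f).

Lemma fab_liftU f a : fab_lift f << a >> = f a.
Proof. by rewrite /fab_lift liftU scale1r. Qed.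

Lemma fab_liftB f : {morph fab_lift f : x y / x - y}.
Proof. exact: raddfB. Qed.

Lemma fab_ind (P : {freeg K} -> Prop) :
  P 0 -> (forall x y, P x -> P y -> P (x - y)) -> (forall a, P << a >>) ->
  forall x, P x.
Proof.
move=> P0 PB PU x.
have PN y : P y -> P (- y) by move=> Py; rewrite -sub0r; apply: PB.
have PD y z : P y -> P z -> P (y + z).
  by move=> Py Pz; rewrite -[z]opprK; apply: PB => //; apply: PN.
have Pn n a : P (<< a >> *+ n).
  by elim: n => [|n IHn]; rewrite ?mulr0n // mulrS; apply: PD.
rewrite -[x]freeg_sumE; elim/big_rec: _ => // a y _ Py; apply: PD => //.
rewrite -[coeff _ _]intz -freegU_mulz.
case: (coeff a x) => n; first exact: Pn.
by rewrite NegzE mulrNz; apply: PN; apply: Pn.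
Qed.

End FreeAbelian.

(* Let K be a commutative monoid and rel a set of relators in the free abelian
   group on K.  If multiplication by elements of K preserves the subgroup
   generated by rel, then the quotient group by that subgroup is a commutative
   ring for the biadditive extension of the product of K.  Both the convolution
   ring and the tensor product of rings are of this form. *)
Record ring_pres := RingPres {
  rp_gen :> choiceType;
  rp_one : rp_gen;
  rp_mul : rp_gen -> rp_gen -> rp_gen;
  rp_rel : {freeg rp_gen} -> Prop;
  rp_mulA : associative rp_mul;
  rp_mulC : commutative rp_mul;
  rp_mul1 : left_id rp_one rp_mul;
  rp_relM : forall a r, rp_rel r ->
    generated rp_rel (fab_lift (fun b => << rp_mul a b >>) r)
}.

Section PresentedRing.
Variable P : ring_pres.
Notation F := {freeg P}.

Definition pres_ring : Type := {ideal_quot (gen_subgroup (@rp_rel P))}.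

HB.instance Definition _ := GRing.Zmodule.on pres_ring.

Definition pres_pi (x : F) : pres_ring :=
  \pi_{ideal_quot (gen_subgroup (@rp_rel P))} x.

Definition pres_gen (a : P) : pres_ring := pres_pi << a >>.

Fact pres_pi_is_zmod_morphism : zmod_morphism pres_pi.
Proof. by move=> x y; rewrite /pres_pi raddfB. Qed.
HB.instance Definition _ :=
  GRing.isZmodMorphism.Build F pres_ring pres_pi pres_pi_is_zmod_morphism.

Lemma pres_piP x y : pres_pi x = pres_pi y <-> generated (@rp_rel P) (x - y).
Proof.
split=> [/eqP|xy].
  by rewrite /pres_pi -Quotient.idealrBE => /gen_subgroupP.
by apply/eqP; rewrite /pres_pi -Quotient.idealrBE; apply/gen_subgroupP.
Qed.

Lemma pres_pi_surj u : exists x, u = pres_pi x.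
Proof. by exists (repr u); rewrite /pres_pi reprK. Qed.

Lemma pres_rel r : rp_rel r -> pres_pi r = 0.
Proof.
move=> Hr; rewrite -(raddf0 pres_pi); apply/pres_piP; rewrite subr0.
exact: generated_mem.
Qed.

Lemma pres_ind (Q : pres_ring -> Prop) :
  Q 0 -> (forall x y, Q x -> Q y -> Q (x - y)) ->
  (forall a, Q (pres_gen a)) -> forall x, Q x.
Proof.
move=> Q0 QB QU; move=> u; have [x ->] := pres_pi_surj u.
elim/fab_ind: x => [|x y Qx Qy|a]; rewrite ?raddf0 ?raddfB //; first exact: QB.
exact: QU.
Qed.

Definition fab_mul (x y : F) : F :=
  fab_lift (fun a => fab_lift (fun b => << rp_mul a b >>) y) x.

Lemma fab_mulU a b : fab_mul << a >> << b >> = << rp_mul a b >>.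
Proof. by rewrite /fab_mul !fab_liftU. Qed.

Lemma fab_mulBl z : {morph fab_mul^~ z : x y / x - y}.
Proof. by move=> x y; rewrite /fab_mul raddfB. Qed.

Lemma fab_mul0l z : fab_mul 0 z = 0.
Proof. by rewrite /fab_mul raddf0. Qed.

Lemma fab_mulC : commutative fab_mul.
Proof.
have mul0r y : fab_mul y 0 = 0.
  elim/fab_ind: y => [|y z IHy IHz|a]; rewrite ?fab_mul0l //.
    by rewrite fab_mulBl IHy IHz subr0.
  by rewrite /fab_mul fab_liftU raddf0.
have mulBr x : {morph fab_mul x : y z / y - z}.
  move=> y z; elim/fab_ind: x => [|u v IHu IHv|a].
  - by rewrite !fab_mul0l subr0.
  - by rewrite !fab_mulBl IHu IHv !opprD !opprK addrACA.
  - by rewrite /fab_mul !fab_liftU raddfB.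
move=> x y; elim/fab_ind: x => [|u v IHu IHv|a].
- by rewrite fab_mul0l mul0r.
- by rewrite fab_mulBl mulBr IHu IHv.
elim/fab_ind: y => [|u v IHu IHv|b]; first by rewrite fab_mul0l mul0r.
  by rewrite fab_mulBl mulBr IHu IHv.
by rewrite !fab_mulU rp_mulC.
Qed.

Lemma fab_mul_rel x r : generated (@rp_rel P) r ->
  generated (@rp_rel P) (fab_mul x r).
Proof.
move=> Hr; elim/fab_ind: x => [|x y Hx Hy|a].
- by rewrite fab_mul0l; apply: generated0.
- by rewrite fab_mulBl; apply: generatedB.
elim: Hr => [|{}r s _ IHr _ IHs|{}r Hr].
- by rewrite fab_mulC fab_mul0l; apply: generated0.
- by rewrite fab_mulC fab_mulBl !(fab_mulC _ << a >>); apply: generatedB.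
by rewrite /fab_mul fab_liftU; apply: rp_relM.
Qed.

Definition pres_mul (x y : pres_ring) : pres_ring :=
  pres_pi (fab_mul (repr x) (repr y)).

Lemma pres_piM x y : pres_mul (pres_pi x) (pres_pi y) = pres_pi (fab_mul x y).
Proof.
have cong u v w : pres_pi u = pres_pi v ->
    pres_pi (fab_mul u w) = pres_pi (fab_mul v w).
  move=> /pres_piP uv; apply/pres_piP; rewrite -fab_mulBl fab_mulC.
  exact: fab_mul_rel.
have reprE u : pres_pi (repr (pres_pi u)) = pres_pi u.
  by rewrite /pres_pi reprK.
by rewrite /pres_mul (cong _ _ _ (reprE x)) fab_mulC (cong _ _ _ (reprE y)) fab_mulC.
Qed.

Lemma pres_mulU a b :
  pres_mul (pres_gen a) (pres_gen b) = pres_gen (rp_mul a b).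
Proof. by rewrite pres_piM fab_mulU. Qed.

Fact pres_mulC : commutative pres_mul.
Proof. by move=> x y; rewrite /pres_mul fab_mulC. Qed.

Lemma pres_mulBl z : {morph pres_mul^~ z : x y / x - y}.
Proof.
move=> x y; have [[x' ->] [y' ->] [z' ->]] :=
  And3 (pres_pi_surj x) (pres_pi_surj y) (pres_pi_surj z).
by rewrite -raddfB !pres_piM fab_mulBl raddfB.
Qed.

Lemma pres_mul0l z : pres_mul 0 z = 0.
Proof. by have := pres_mulBl z 0 0; rewrite /= !subrr. Qed.

Fact pres_mulDl : left_distributive pres_mul +%R.
Proof.
move=> x y z; rewrite -{1}[y]opprK -[- y]sub0r pres_mulBl pres_mulBl.
by rewrite pres_mul0l sub0r opprK.
Qed.

Fact pres_mul1l : left_id (pres_gen (rp_one P)) pres_mul.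
Proof.
move=> x; elim/pres_ind: x => [|x y IHx IHy|a].
- by rewrite pres_mulC pres_mul0l.
- by rewrite pres_mulC pres_mulBl !(pres_mulC _ (pres_gen _)) IHx IHy.
by rewrite pres_mulU rp_mul1.
Qed.

Fact pres_mulA : associative pres_mul.
Proof.
have swap x y z : pres_mul x (pres_mul y z) = pres_mul (pres_mul z y) x.
  by rewrite pres_mulC (pres_mulC y).
suff H x y z : pres_mul (pres_mul z y) x = pres_mul (pres_mul x y) z.
  by move=> x y z; rewrite swap H.
elim/pres_ind: x => [|x u IHx IHu|a].
- by rewrite !pres_mul0l pres_mulC pres_mul0l.
- by rewrite pres_mulC !pres_mulBl -IHx -IHu !(pres_mulC (pres_mul z y)).
elim/pres_ind: z => [|x u IHx IHu|c].
- by rewrite !pres_mul0l pres_mulC pres_mul0l.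
- rewrite [RHS]pres_mulC !pres_mulBl IHx IHu.
  by rewrite !(pres_mulC (pres_mul (pres_gen a) y)).
rewrite (pres_mulC _ y) (pres_mulC (pres_gen a)).
elim/pres_ind: y => [|x u IHx IHu|b]; first by rewrite !pres_mul0l.
  by rewrite !pres_mulBl IHx IHu.
rewrite !pres_mulU; congr pres_gen.
by rewrite -!rp_mulA (rp_mulC c).
Qed.

HB.instance Definition _ := GRing.Zmodule_isComPzRing.Build pres_ring
  pres_mulA pres_mulC pres_mul1l pres_mulDl.

Lemma pres_genM a b : pres_gen (rp_mul a b) = pres_gen a * pres_gen b.
Proof. by rewrite -pres_mulU. Qed.

Lemma pres_gen1 : pres_gen (rp_one P) = 1.
Proof. by []. Qed.

End PresentedRing.

Section TensorProduct.
Variables A B : comPzRingType.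

(* The tensor product over Z: balancedness for integer scalars follows from
   biadditivity. *)
Definition tens_mul (s t : A * B) : A * B := (s.1 * t.1, s.2 * t.2).

Variant tens_rel : {freeg (A * B)%type} -> Prop :=
| TensRelL a a' b :
    tens_rel (<< (a + a', b) >> - << (a, b) >> - << (a', b) >>)
| TensRelR a b b' :
    tens_rel (<< (a, b + b') >> - << (a, b) >> - << (a, b') >>).

Fact tens_mulA : associative tens_mul.
Proof. by move=> s t u; rewrite /tens_mul !mulrA. Qed.
Fact tens_mulC : commutative tens_mul.
Proof. by move=> s t; rewrite /tens_mul [s.1 * _]mulrC [s.2 * _]mulrC. Qed.
Fact tens_mul1 : left_id (1, 1) tens_mul.
Proof. by case=> a b; rewrite /tens_mul !mul1r. Qed.
Fact tens_relM s r : tens_rel r ->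
  generated tens_rel (fab_lift (fun t => << tens_mul s t >>) r).
Proof.
case=> [a a' b|a b b']; rewrite 2!fab_liftB 3!fab_liftU /tens_mul /= mulrDr;
  apply: generated_mem; [exact: TensRelL | exact: TensRelR].
Qed.

Definition tens_pres : ring_pres := RingPres tens_mulA tens_mulC tens_mul1 tens_relM.

Definition tensor_ring : comPzRingType := pres_ring tens_pres.

Definition pure_tensor (a : A) (b : B) : tensor_ring := @pres_gen tens_pres (a, b).

Lemma pure_tensorDl a a' b :
  pure_tensor (a + a') b = pure_tensor a b + pure_tensor a' b.
Proof.
have /eqP := @pres_rel tens_pres _ (TensRelL a a' b).
rewrite (raddfB (@pres_pi tens_pres)) (raddfB (@pres_pi tens_pres)).
by rewrite -addrA -opprD subr_eq0 => /eqP.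
Qed.

Lemma pure_tensorDr a b b' :
  pure_tensor a (b + b') = pure_tensor a b + pure_tensor a b'.
Proof.
have /eqP := @pres_rel tens_pres _ (TensRelR a b b').
rewrite (raddfB (@pres_pi tens_pres)) (raddfB (@pres_pi tens_pres)).
by rewrite -addrA -opprD subr_eq0 => /eqP.
Qed.

Lemma pure_tensorM a b a' b' :
  pure_tensor (a * a') (b * b') = pure_tensor a b * pure_tensor a' b'.
Proof. exact: (@pres_genM tens_pres (a, b) (a', b')). Qed.

End TensorProduct.

Section NilpotentEndomorphisms.
Import VectorInternalTheory.
Variable k : fieldType.

(* An object is a nilpotent endomorphism of k^n, written as a matrix acting on
   column vectors.  Every pair (V, phi) with V of finite dimension is isomorphic
   to one of these (nilmx_complete), so the isomorphism classes are the same; a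
   quotient of the type of all such pairs would live in too large a universe to
   carry a ring structure. *)
Record nilmx := NilMx {
  nil_dim : nat;
  nil_mx :> 'M[k]_nil_dim;
  nil_mxP : exists N, nil_mx ^+ N = 0
}.

HB.instance Definition _ := gen_eqMixin nilmx.
HB.instance Definition _ := gen_choiceMixin nilmx.

Definition nil_isom (V W : nilmx) : Prop :=
  exists (f : 'M[k]_(nil_dim W, nil_dim V)) (g : 'M[k]_(nil_dim V, nil_dim W)),
    [/\ g *m f = 1%:M, f *m g = 1%:M & f *m nil_mx V = nil_mx W *m f].

Lemma nilmx_complete (V : vectType k) (phi : 'End(V)) N :
  (forall v, iter N phi v = 0) ->
  exists (W : nilmx) (f : {linear V -> 'cV[k]_(nil_dim W)}),
    bijective f /\ forall v, f (phi v) = nil_mx W *m f v.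
Proof.
move=> phiN; pose M : 'M[k]_(dim V) := (f2mx phi)^T.
pose f v : 'cV[k]_(dim V) := (v2r v)^T.
have fphi v : f (phi v) = M *m f v.
  by rewrite /f /M -trmx_mul; congr (_^T); rewrite unlock /= r2vK.
pose g (x : 'cV[k]_(dim V)) : V := r2v x^T.
have gf : cancel f g by move=> v; rewrite /f /g trmxK v2rK.
have fg : cancel g f by move=> x; rewrite /f /g r2vK trmxK.
have fX n v : f (iter n phi v) = M ^+ n *m f v.
  elim: n => [|n IHn]; first by rewrite expr0 mul1mx.
  by rewrite iterS fphi IHn exprS -[M * _]/(M *m _) mulmxA.
have M0 : M ^+ N = 0.
  apply/trmx_inj/row_matrixP=> i; rewrite -!tr_col; congr (_^T).
  by rewrite !colE -(fg (delta_mx i 0)) -fX phiN mul0mx /f linear0 trmx0.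
have f_lin : linear f by move=> a u v; rewrite /f !linearP.
pose fM := GRing.isLinear.Build _ _ _ _ _ f_lin.
pose fL : {linear _ -> _} := HB.pack f fM.
exists (NilMx (ex_intro _ N M0)), fL.
by split=> //; exists g.
Qed.

Lemma nil_isom_refl V : nil_isom V V.
Proof. by exists 1%:M, 1%:M; rewrite !mul1mx mulmx1. Qed.

Lemma nil_isom_sym V W : nil_isom V W -> nil_isom W V.
Proof.
move=> [f [g [gf fg fV]]]; exists g, f; split=> //.
by rewrite -[LHS]mulmx1 -fg -!mulmxA [_ *m (f *m g)]mulmxA -fV !mulmxA gf mul1mx.
Qed.

Lemma nil_isom_trans W V U : nil_isom V W -> nil_isom W U -> nil_isom V U.
Proof.
move=> [f [g [gf fg fV]]] [f' [g' [gf' fg' fV']]].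
exists (f' *m f), (g *m g'); split.
- by rewrite mulmxA -[_ *m g' *m f']mulmxA gf' mulmx1.
- by rewrite mulmxA -[_ *m f *m g]mulmxA fg mulmx1.
by rewrite -mulmxA fV !mulmxA fV'.
Qed.

Definition nil_isomb : rel nilmx := fun V W => `[< nil_isom V W >].

Fact nil_isomb_equiv : equiv_class_of nil_isomb.
Proof.
split=> [V|V W|W V U]; first exact/asboolP/nil_isom_refl.
  by apply/asboolP/asboolP; apply: nil_isom_sym.
by move=> /asboolP VW /asboolP WU; apply/asboolP/(nil_isom_trans VW).
Qed.
Canonical nil_isomb_equiv_rel := EquivRelPack nil_isomb_equiv.

Definition isoclass := {eq_quot nil_isomb}.
HB.instance Definition _ := Choice.on isoclass.

Definition cls (V : nilmx) : isoclass := \pi_{eq_quot nil_isomb} V.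

Lemma cls_eq V W : cls V = cls W <-> nil_isom V W.
Proof.
by split=> [/eqquotP/asboolP|VW] //; apply/eqquotP/asboolP.
Qed.

Lemma cls_repr c : cls (repr c) = c.
Proof. exact: reprK. Qed.

Lemma reindex_isom (V W : nilmx) (s : 'I_(nil_dim V) -> 'I_(nil_dim W))
    (t : 'I_(nil_dim W) -> 'I_(nil_dim V)) :
  cancel s t -> cancel t s -> (forall i j, nil_mx V i j = nil_mx W (s i) (s j)) ->
  nil_isom V W.
Proof.
move=> st ts E.
exists (\matrix_(i, j) (i == s j)%:R), (\matrix_(i, j) (s i == j)%:R); split.
- apply/matrixP=> i j; rewrite !mxE (bigD1 (s i)) //= !mxE eqxx mul1r.
  rewrite (can_eq st) big1 ?addr0 // => l /negbTE ne; rewrite !mxE.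
  by rewrite eq_sym ne mul0r.
- apply/matrixP=> i j; rewrite !mxE (bigD1 (t i)) //= !mxE ts eqxx mul1r.
  rewrite big1 ?addr0 // => l ne; rewrite !mxE.
  case: eqP => [il|_]; last by rewrite mul0r.
  by rewrite il st eqxx in ne.
apply/matrixP=> i j; rewrite !mxE (bigD1 (t i)) //= !mxE ts eqxx mul1r.
rewrite [X in _ + X]big1 ?addr0; last first.
  move=> l ne; rewrite !mxE; case: eqP => [il|_]; last by rewrite mul0r.
  by rewrite il st eqxx in ne.
rewrite (bigD1 (s j)) //= !mxE eqxx mulr1 big1 ?addr0.
  by rewrite E ts.
by move=> l /negbTE ne; rewrite !mxE ne mulr0.
Qed.

Fact dsum_mxP (V W : nilmx) :
  exists N, (block_mx (nil_mx V) 0 0 (nil_mx W)) ^+ N = 0.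
Proof.
have [[N HN] [M HM]] := (nil_mxP V, nil_mxP W); exists (N + M)%N.
have blockX n : (block_mx (nil_mx V) 0 0 (nil_mx W)) ^+ n =
    block_mx (nil_mx V ^+ n) 0 0 (nil_mx W ^+ n).
  elim: n => [|n IHn]; first by rewrite !expr0 -scalar_mx_block.
  rewrite !exprS IHn -[LHS]/(_ *m _) mulmx_block.
  by rewrite !mul0mx !mulmx0 !addr0 add0r.
by rewrite blockX !exprD HN HM mul0r mulr0 -block_mx0.
Qed.

Definition dsum (V W : nilmx) : nilmx := NilMx (dsum_mxP V W).

(* phi (x) id + id (x) phi', with Kronecker products. *)
Definition tens_mx m n (A : 'M[k]_m) (B : 'M[k]_n) : 'M[k]_(m * n) :=
  tensmx A 1%:M + tensmx 1%:M B.

Lemma tens11 m n : tensmx (1%:M : 'M[k]_m) (1%:M : 'M[k]_n) = 1%:M.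
Proof.
apply/matrixP=> i j; case: (mxtens_indexP i) => i1 i2.
case: (mxtens_indexP j) => j1 j2; rewrite tensmxE !mxE.
by rewrite (can_eq (@mxtens_indexK m n)) xpair_eqE -natrM mulnb.
Qed.

Lemma tens1X m n (A : 'M[k]_m) N :
  (tensmx A (1%:M : 'M[k]_n)) ^+ N = tensmx (A ^+ N) 1%:M.
Proof.
elim: N => [|N IHN]; first by rewrite !expr0 -[in RHS]/(1%:M) tens11.
by rewrite !exprS IHN -[LHS]/(_ *m _) tensmx_mul mulmx1.
Qed.

Lemma tensX1 m n (B : 'M[k]_n) N :
  (tensmx (1%:M : 'M[k]_m) B) ^+ N = tensmx 1%:M (B ^+ N).
Proof.
elim: N => [|N IHN]; first by rewrite !expr0 -[in RHS]/(1%:M) tens11.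
by rewrite !exprS IHN -[LHS]/(_ *m _) tensmx_mul mulmx1.
Qed.

Lemma tens_comm m n (A : 'M[k]_m) (B : 'M[k]_n) :
  GRing.comm (tensmx A 1%:M) (tensmx 1%:M B).
Proof. exact: etrans (esym (tensmx_decr A B)) (tensmx_decl A B). Qed.

Fact tensor_mxP (V W : nilmx) : exists N, (tens_mx (nil_mx V) (nil_mx W)) ^+ N = 0.
Proof.
have [[N HN] [M HM]] := (nil_mxP V, nil_mxP W); exists (N + M)%N.
rewrite /tens_mx exprDn_comm; last exact: tens_comm.
rewrite big1 // => i _; rewrite tens1X tensX1.
case: (leqP M i) => [Mi|iM].
  by rewrite -(subnK Mi) exprD HM mulr0 tensmx0 mulr0 mul0rn.
have -> : (N + M - i = N + (M - i))%N by rewrite addnBA // ltnW.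
by rewrite exprD HN mul0r tens0mx mul0r mul0rn.
Qed.

Definition tensor (V W : nilmx) : nilmx := NilMx (tensor_mxP V W).

Definition unit_nil : nilmx :=
  @NilMx 1 0 (ex_intro _ 1%N (expr1 _)).

Lemma tensorE (V W : nilmx) i1 i2 j1 j2 :
  nil_mx (tensor V W) (mxtens_index (i1, i2)) (mxtens_index (j1, j2)) =
  nil_mx V i1 j1 * (i2 == j2)%:R + (i1 == j1)%:R * nil_mx W i2 j2.
Proof. by rewrite /= /tens_mx mxE !tensmxE !mxE. Qed.

Lemma tensor_isomr U V W : nil_isom V W -> nil_isom (tensor U V) (tensor U W).
Proof.
move=> [f [g [gf fg fV]]].
exists (tensmx 1%:M f), (tensmx 1%:M g); split.
- by rewrite tensmx_mul mulmx1 gf tens11.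
- by rewrite tensmx_mul mulmx1 fg tens11.
by rewrite /= /tens_mx mulmxDr mulmxDl !tensmx_mul !mulmx1 !mul1mx fV.
Qed.

Lemma tensor_comm U V : nil_isom (tensor U V) (tensor V U).
Proof.
pose s m n (i : 'I_(m * n)) : 'I_(n * m) :=
  mxtens_index ((mxtens_unindex i).2, (mxtens_unindex i).1).
have sK m n : cancel (@s m n) (@s n m).
  by move=> i; case: (mxtens_indexP i) => i1 i2; rewrite /s !mxtens_indexK.
apply: (@reindex_isom (tensor U V) (tensor V U) (@s _ _) (@s _ _) (sK _ _) (sK _ _)) => i j.
case: (mxtens_indexP i) => i1 i2; case: (mxtens_indexP j) => j1 j2.
by rewrite /s !mxtens_indexK /= !tensorE addrC mulrC [X in _ + X]mulrC.
Qed.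

Lemma tensor_isom U U' V V' : nil_isom U U' -> nil_isom V V' ->
  nil_isom (tensor U V) (tensor U' V').
Proof.
move=> UU' VV'; apply: nil_isom_trans (tensor_isomr U VV') _.
apply: nil_isom_trans (tensor_comm _ _) _.
apply: nil_isom_trans (tensor_isomr V' UU') _; exact: tensor_comm.
Qed.

Lemma tensor_assoc U V W :
  nil_isom (tensor U (tensor V W)) (tensor (tensor U V) W).
Proof.
pose s m n l (i : 'I_(m * (n * l))) : 'I_(m * n * l) :=
  let: (i1, i') := mxtens_unindex i in let: (i2, i3) := mxtens_unindex i' in
  mxtens_index (mxtens_index (i1, i2), i3).
pose t m n l (i : 'I_(m * n * l)) : 'I_(m * (n * l)) :=
  let: (i', i3) := mxtens_unindex i in let: (i1, i2) := mxtens_unindex i' in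
  mxtens_index (i1, mxtens_index (i2, i3)).
have sE m n l i1 i2 i3 : @s m n l (mxtens_index (i1, mxtens_index (i2, i3))) =
  mxtens_index (mxtens_index (i1, i2), i3) by rewrite /s !mxtens_indexK.
have tE m n l i1 i2 i3 : @t m n l (mxtens_index (mxtens_index (i1, i2), i3)) =
  mxtens_index (i1, mxtens_index (i2, i3)) by rewrite /t !mxtens_indexK.
apply: (@reindex_isom (tensor U (tensor V W)) (tensor (tensor U V) W)
  (@s _ _ _) (@t _ _ _)) => [i|i|i j].
- by case: (mxtens_indexP i) => i1 i'; case: (mxtens_indexP i') => i2 i3;
    rewrite sE tE.
- by case: (mxtens_indexP i) => i' i3; case: (mxtens_indexP i') => i1 i2;
    rewrite tE sE.
case: (mxtens_indexP i) => i1 i'; case: (mxtens_indexP i') => i2 i3.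
case: (mxtens_indexP j) => j1 j'; case: (mxtens_indexP j') => j2 j3.
rewrite !sE !tensorE !(can_eq (@mxtens_indexK _ _)) !xpair_eqE.
by rewrite mulrDl mulrDr addrA -!mulnb !natrM !mulrA.
Qed.

Lemma tensor_unit V : nil_isom (tensor unit_nil V) V.
Proof.
apply: (@reindex_isom (tensor unit_nil V) V
  (fun i => (mxtens_unindex i).2) (fun i => mxtens_index (ord0, i))).
- by move=> i; case: (mxtens_indexP i) => i1 i2; rewrite mxtens_indexK (ord1 i1).
- by move=> i; rewrite mxtens_indexK.
move=> i j; case: (mxtens_indexP i) => i1 i2; case: (mxtens_indexP j) => j1 j2.
by rewrite tensorE !mxtens_indexK (ord1 i1) (ord1 j1) /= mxE mul0r add0r mul1r.
Qed.

Lemma tensor_dsumr U V W :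
  nil_isom (tensor U (dsum V W)) (dsum (tensor U V) (tensor U W)).
Proof.
pose s m n l (i : 'I_(m * (n + l))) : 'I_(m * n + m * l) :=
  let: (i1, i') := mxtens_unindex i in
  match fintype.split i' with
  | inl i2 => lshift _ (mxtens_index (i1, i2))
  | inr i2 => rshift _ (mxtens_index (i1, i2))
  end.
pose t m n l (i : 'I_(m * n + m * l)) : 'I_(m * (n + l)) :=
  match fintype.split i with
  | inl i' => let: (i1, i2) := mxtens_unindex i' in mxtens_index (i1, lshift _ i2)
  | inr i' => let: (i1, i2) := mxtens_unindex i' in mxtens_index (i1, rshift _ i2)
  end.
have sL m n l i1 i2 : @s m n l (mxtens_index (i1, lshift _ i2)) =
  lshift _ (mxtens_index (i1, i2)).
  by rewrite /s mxtens_indexK (unsplitK (inl i2)).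
have sR m n l i1 i2 : @s m n l (mxtens_index (i1, rshift _ i2)) =
  rshift _ (mxtens_index (i1, i2)).
  by rewrite /s mxtens_indexK (unsplitK (inr i2)).
have tL m n l i1 i2 : @t m n l (lshift _ (mxtens_index (i1, i2))) =
  mxtens_index (i1, lshift _ i2).
  by rewrite /t (unsplitK (inl _)) mxtens_indexK.
have tR m n l i1 i2 : @t m n l (rshift _ (mxtens_index (i1, i2))) =
  mxtens_index (i1, rshift _ i2).
  by rewrite /t (unsplitK (inr _)) mxtens_indexK.
apply: (@reindex_isom (tensor U (dsum V W)) (dsum (tensor U V) (tensor U W))
  (@s _ _ _) (@t _ _ _)) => [i|i|i j].
- case: (mxtens_indexP i) => i1 i'; case: (split_ordP i') => i2 ->.
    by rewrite sL tL.
  by rewrite sR tR.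
- case: (split_ordP i) => i' ->; case: (mxtens_indexP i') => i1 i2.
    by rewrite tL sL.
  by rewrite tR sR.
case: (mxtens_indexP i) => i1 i'; case: (mxtens_indexP j) => j1 j'.
case: (split_ordP i') => i2 ->; case: (split_ordP j') => j2 ->;
  rewrite ?sL ?sR tensorE [RHS]/= ?(block_mxEul, block_mxEur, block_mxEdl, block_mxEdr)
  -?[tens_mx _ _]/(nil_mx (tensor _ _)) ?tensorE ?(inj_eq (@lshift_inj _ _))
  ?(inj_eq (@rshift_inj _ _)) ?eq_lrshift ?eq_rlshift /=
  ?(block_mxEul, block_mxEur, block_mxEdl, block_mxEdr) ?mxE ?mulr0 ?addr0 //.
Qed.

Definition cls_mul (c d : isoclass) : isoclass := cls (tensor (repr c) (repr d)).

Lemma cls_mulE V W : cls_mul (cls V) (cls W) = cls (tensor V W).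
Proof. by apply/cls_eq/tensor_isom; apply/cls_eq; rewrite cls_repr. Qed.

Fact cls_mulA : associative cls_mul.
Proof.
move=> c d e; rewrite -[c]cls_repr -[d]cls_repr -[e]cls_repr !cls_mulE.
exact/cls_eq/tensor_assoc.
Qed.
Fact cls_mulC : commutative cls_mul.
Proof.
move=> c d; rewrite -[c]cls_repr -[d]cls_repr !cls_mulE.
exact/cls_eq/tensor_comm.
Qed.
Fact cls_mul1 : left_id (cls unit_nil) cls_mul.
Proof. by move=> c; rewrite -[c]cls_repr cls_mulE; apply/cls_eq/tensor_unit. Qed.

Variant dsum_rel : {freeg isoclass} -> Prop :=
| DsumRel V V' V'' of nil_isom V (dsum V' V'') :
    dsum_rel (<< cls V >> - << cls V' >> - << cls V'' >>).

Fact dsum_relM c r : dsum_rel r ->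
  generated dsum_rel (fab_lift (fun d => << cls_mul c d >>) r).
Proof.
case=> V V' V'' VV; rewrite !fab_liftB !fab_liftU -[c]cls_repr !cls_mulE.
apply/generated_mem/DsumRel; apply: nil_isom_trans (tensor_dsumr _ _ _).
exact: tensor_isomr.
Qed.

Definition conv_pres : ring_pres :=
  RingPres cls_mulA cls_mulC cls_mul1 dsum_relM.

Definition conv_ring : comPzRingType := pres_ring conv_pres.

Definition conv_cls (V : nilmx) : conv_ring := @pres_gen conv_pres (cls V).

Definition jordan n : 'M[k]_n := \matrix_(i, j) (i.+1 == j)%:R.

Lemma jordanX n N : jordan n ^+ N = \matrix_(i, j) ((i + N)%N == j)%:R.
Proof.
elim: N => [|N IHN].
  by apply/matrixP=> i j; rewrite expr0 !mxE addn0.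
rewrite exprSr IHN -[LHS]/(_ *m _); apply/matrixP=> i j; rewrite !mxE.
have [iN|Ni] := ltnP (i + N)%N n.
  rewrite (bigD1 (Ordinal iN)) //= !mxE eqxx mul1r addnS big1 ?addr0 //.
  move=> l ne; rewrite !mxE; case: eqP => [E|_]; last by rewrite mul0r.
  by case/eqP: ne; apply: val_inj.
rewrite big1 => [|l _]; last first.
  by rewrite !mxE (gtn_eqF (leq_trans (ltn_ord l) Ni)) mul0r.
by rewrite gtn_eqF // addnS ltnS (leq_trans (ltnW (ltn_ord j)) Ni).
Qed.

Lemma jordan_nil n : jordan n ^+ n = 0.
Proof.
rewrite jordanX; apply/matrixP=> i j; rewrite !mxE gtn_eqF //.
exact: leq_trans (ltn_ord j) (leq_addl _ _).
Qed.

Definition jordan_nilmx n : nilmx := NilMx (ex_intro _ n (jordan_nil n)).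

(* The class f_n; here n = 0 is allowed, with f_0 = 0. *)
Definition jordan_cls n : conv_ring := conv_cls (jordan_nilmx n).

End NilpotentEndomorphisms.

Section ConvolutionRing.
Variable k : fieldType.
Local Notation R := (conv_ring k).

Lemma conv_clsM (V W : nilmx k) :
  conv_cls (tensor V W) = conv_cls V * conv_cls W.
Proof. by rewrite /conv_cls -pres_genM /= cls_mulE. Qed.

Lemma conv_clsD (V W : nilmx k) : conv_cls (dsum V W) = conv_cls V + conv_cls W.
Proof.
have := pres_rel (P := conv_pres k) (DsumRel (nil_isom_refl (dsum V W))).
rewrite !raddfB /= => /eqP; rewrite -addrA -opprD subr_eq0 => /eqP; exact.
Qed.

Lemma conv_cls_isom (V W : nilmx k) : nil_isom V W -> conv_cls V = conv_cls W.
Proof. by move=> VW; rewrite /conv_cls (iffRL (cls_eq V W) VW). Qed.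

Lemma jordan_cls1 : jordan_cls k 1 = 1.
Proof.
apply: conv_cls_isom; apply: (@reindex_isom _ (jordan_nilmx k 1) (unit_nil k) id id).
- by [].
- by [].
by move=> i j; rewrite /= !mxE (ord1 j).
Qed.

Definition zero_nil m : nilmx k := @NilMx k m 0 (ex_intro _ 1%N (expr1 _)).

Lemma conv_cls_zero m : conv_cls (zero_nil m) = m%:R.
Proof.
elim: m => [|m IHm].
  apply: (addrI (conv_cls (zero_nil 0))); rewrite addr0 -conv_clsD.
  apply/esym/conv_cls_isom.
  by exists 0, 0; split; apply/matrixP; case.
rewrite -natr1 addrC -IHm -[1]/(conv_cls (unit_nil k)) -conv_clsD.
apply: conv_cls_isom.
apply: (@reindex_isom _ (zero_nil m.+1) (dsum (unit_nil k) (zero_nil m)) id id).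
- by [].
- by [].
by move=> i j; rewrite /= -[block_mx _ _ _ _]/(block_mx 0 0 0 0) block_mx0 !mxE.
Qed.

Variable p : nat.
Hypothesis charkp : p \in [pchar k].

Lemma mx_exprDn_pchar N (x y : 'M[k]_N) j : GRing.comm x y ->
  (x + y) ^+ (p ^ j) = x ^+ (p ^ j) + y ^+ (p ^ j).
Proof.
case: N x y => [|N] x y cxy; first by rewrite [LHS]thinmx0 [RHS]thinmx0.
have charM : p \in [pchar 'M[k]_N.+1].
  exact: (rmorph_pchar (@scalar_mx k N.+1)).
elim: j => [|j IHj]; first by rewrite expn0 !expr1.
rewrite expnSr !exprM IHj.
have := pFrobenius_autD_comm charM
  (commrX (p ^ j) (commr_sym (commrX (p ^ j) (commr_sym cxy)))).
by rewrite !pFrobenius_autE.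
Qed.

Section JordanProduct.
Variables i j : nat.
Hypothesis le_ij : (i <= j)%N.
Let m := (p ^ i)%N.
Let n := (p ^ j)%N.
Let A : 'M[k]_(m * n) := tensmx (jordan k m) 1%:M.
Let B : 'M[k]_(m * n) := tensmx 1%:M (jordan k n).

Let p_gt0 : (0 < p)%N.
Proof. exact/prime_gt0/(pcharf_prime charkp). Qed.
Let m_gt0 : (0 < m)%N. Proof. by rewrite expn_gt0 p_gt0. Qed.
Let n_gt0 : (0 < n)%N. Proof. by rewrite expn_gt0 p_gt0. Qed.

Let e : 'rV[k]_(m * n) :=
  delta_mx 0 (mxtens_index (Ordinal m_gt0, Ordinal n_gt0)).

Let AX0 a : (m <= a)%N -> A ^+ a = 0.
Proof.
by move=> ma; rewrite /A tens1X -(subnK ma) exprD jordan_nil mulr0 tens0mx.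
Qed.

Let BX0 b : (n <= b)%N -> B ^+ b = 0.
Proof.
by move=> nb; rewrite /B tensX1 -(subnK nb) exprD jordan_nil mulr0 tensmx0.
Qed.

Let comAB : GRing.comm A B. Proof. exact: tens_comm. Qed.

Let basisE (a : 'I_m) (b : 'I_n) :
  e *m A ^+ a *m B ^+ b = delta_mx 0 (mxtens_index (a, b)).
Proof.
rewrite -mulmxA /A /B tens1X tensX1 tensmx_mul mulmx1 mul1mx !jordanX /e -rowE.
apply/matrixP=> x y; rewrite (ord1 x); case: (mxtens_indexP y) => c d.
rewrite mxE tensmxE !mxE /= !add0n -natrM mulnb; congr (_%:R : k).
by rewrite (can_eq (@mxtens_indexK _ _)) xpair_eqE (eq_sym c) (eq_sym d).
Qed.

Let row_ext (X Y : 'M[k]_(m * n)) :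
  (forall a b, e *m A ^+ a *m B ^+ b *m X = e *m A ^+ a *m B ^+ b *m Y) -> X = Y.
Proof.
move=> E; apply/row_matrixP=> r; rewrite !rowE.
by case: (mxtens_indexP r) => a b; rewrite -basisE.
Qed.

Let commX (X D : 'M[k]_(m * n)) c : D *m X = X *m D -> D ^+ c *m X = X *m D ^+ c.
Proof. by move=> DX; apply/esym/(@commrX _ X D c)/esym. Qed.

Let expSr (D : 'M[k]_(m * n)) c : D ^+ c.+1 = D ^+ c *m D.
Proof. exact: exprSr. Qed.

Section Shear.
Variable C : 'M[k]_(m * n).
Hypotheses (comAC : GRing.comm A C) (CX0 : forall b, (n <= b)%N -> C ^+ b = 0).

Definition shear : 'M[k]_(m * n) := \matrix_(r < m * n)
  (e *m A ^+ nat_of_ord (mxtens_unindex r).1 *m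
        C ^+ nat_of_ord (mxtens_unindex r).2).

Let shearX a b : e *m A ^+ a *m B ^+ b *m shear = e *m A ^+ a *m C ^+ b.
Proof.
case: (leqP m a) => [ma|am]; first by rewrite AX0 // mulmx0 !mul0mx.
case: (leqP n b) => [nb|bn]; first by rewrite BX0 // CX0 // !mulmx0 mul0mx.
by rewrite (basisE (Ordinal am) (Ordinal bn)) -rowE rowK mxtens_indexK.
Qed.

Lemma shear_e : e *m shear = e.
Proof. by have := shearX 0 0; rewrite !expr0 !mulmx1. Qed.

Lemma shear_B : B *m shear = shear *m C.
Proof.
apply: row_ext => a b; rewrite !mulmxA shearX.
by have := shearX a b.+1; rewrite !expSr !mulmxA.
Qed.

Lemma shear_A : A *m shear = shear *m A.
Proof.
apply: row_ext => a b; rewrite !mulmxA shearX -[_ *m C ^+ b *m A]mulmxA.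
rewrite (commX _ (esym comAC)) -[_ *m B ^+ b *m A]mulmxA.
rewrite (commX _ (esym comAB)) !mulmxA.
by have := shearX a.+1 b; rewrite !expSr !mulmxA.
Qed.

End Shear.

Let shear_id (X : 'M[k]_(m * n)) :
  e *m X = e -> A *m X = X *m A -> B *m X = X *m B -> X = 1%:M.
Proof.
move=> eX AX BX; apply: row_ext => a b; rewrite mulmx1.
rewrite -[_ *m B ^+ b *m X]mulmxA commX // mulmxA.
by rewrite -[_ *m A ^+ a *m X]mulmxA (@commX X A) // mulmxA eX.
Qed.

Lemma jordan_tensor :
  nil_isom (tensor (jordan_nilmx k m) (jordan_nilmx k n))
           (tensor (zero_nil m) (jordan_nilmx k n)).
Proof.
have le_mn : (m <= n)%N by apply: leq_pexp2l.
have X0 (D : 'M[k]_(m * n)) : GRing.comm D B -> D ^+ n = 0 ->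
    forall b, (n <= b)%N -> (D + B) ^+ b = 0.
  move=> cDB Dn b nb; rewrite -(subnK nb) exprD mx_exprDn_pchar // Dn.
  by rewrite BX0 // addr0 mulr0.
have cAAB : GRing.comm A (A + B) by apply: commrD => //; apply: commr_refl.
have cANAB : GRing.comm A (- A + B).
  by apply: commrD => //; apply: commrN; apply: commr_refl.
have PX0 := X0 A comAB (AX0 le_mn).
have cNAB : GRing.comm (- A) B by apply/commr_sym/commrN/commr_sym.
have QX0 : forall b, (n <= b)%N -> (- A + B) ^+ b = 0.
  by apply: X0 => //; rewrite exprNn AX0 // mulr0.
pose P := shear (A + B); pose Q := shear (- A + B).
have PQ : P *m Q = 1%:M.
  apply: shear_id.
  - by rewrite mulmxA !shear_e.
  - by rewrite mulmxA shear_A // -!mulmxA shear_A.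
  rewrite mulmxA shear_B // -!mulmxA; congr (_ *m _).
  by rewrite mulmxDl shear_A // shear_B // mulmxDr mulmxN addNKr.
exists P, Q; split=> //; first exact: mulmx1C.
by rewrite /= /tens_mx tens0mx add0r -/A -/B shear_B.
Qed.

Lemma jordan_clsM : jordan_cls k m * jordan_cls k n = jordan_cls k n *+ m.
Proof.
by rewrite -conv_clsM (conv_cls_isom jordan_tensor) conv_clsM conv_cls_zero mulr_natl.
Qed.

End JordanProduct.

Definition conv_subgroup (nu : nat) : {pred R} :=
  gen_subgroup (fun x => exists2 i, (i <= nu)%N & x = jordan_cls k (p ^ i)).

(* The proof of characteristic p is a parameter because the subring structure
   depends on it: it relies on f_(p^i) f_(p^j) = p^i f_(p^j) for i <= j. *)
Definition conv_infty of p \in [pchar k] : {pred R} :=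
  fun x => `[< exists nu, x \in conv_subgroup nu >].

Lemma generated_mul (G : comPzRingType) (S : G -> Prop) :
  (forall x y, S x -> S y -> generated S (x * y)) ->
  forall x y, generated S x -> generated S y -> generated S (x * y).
Proof.
move=> SM x y Hx Hy; elim: Hx => [|{}x x' _ IHx _ IHx'|{}x Sx].
- by rewrite mul0r; apply: generated0.
- by rewrite mulrBl; apply: generatedB.
elim: Hy => [|{}y y' _ IHy _ IHy'|{}y Sy]; last exact: SM.
  by rewrite mulr0; apply: generated0.
by rewrite mulrBr; apply: generatedB.
Qed.

Fact conv_subgroup_subring nu : subring_closed (conv_subgroup nu).
Proof.
split=> [|x y|x y].
- apply/gen_subgroupP/generated_mem; exists 0%N => //.
  by rewrite expn0 jordan_cls1.
- exact: rpredB.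
move=> /gen_subgroupP Hx /gen_subgroupP Hy; apply/gen_subgroupP.
apply: generated_mul Hx Hy => _ _ [i ilt ->] [j jlt ->].
wlog le_ij: i j ilt jlt / (i <= j)%N.
  by move=> W; case: (leqP i j) => [|/ltnW] ij; [|rewrite mulrC]; apply: W.
rewrite jordan_clsM //; apply/gen_subgroupP/rpredMn/gen_subgroupP.
by apply: generated_mem; exists j.
Qed.

Lemma conv_subgroupS nu nu' : (nu <= nu')%N ->
  {subset conv_subgroup nu <= conv_subgroup nu'}.
Proof.
move=> le x /gen_subgroupP Hx; apply/gen_subgroupP.
elim: Hx => [|y z _ IHy _ IHz|y [i ile ->]].
- exact: generated0.
- exact: generatedB.
by apply: generated_mem; exists i => //; apply: leq_trans le.
Qed.

Fact conv_infty_subring : subring_closed (conv_infty charkp).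
Proof.
have join x y : x \in conv_infty charkp -> y \in conv_infty charkp ->
    exists nu, x \in conv_subgroup nu /\ y \in conv_subgroup nu.
  move=> /asboolP[nu Hx] /asboolP[nu' Hy]; exists (maxn nu nu').
  by split; [apply: conv_subgroupS Hx; apply: leq_maxl
            |apply: conv_subgroupS Hy; apply: leq_maxr].
split=> [|x y Hx Hy|x y Hx Hy]; apply/asboolP.
- by exists 0%N; case: (conv_subgroup_subring 0).
- have [nu [? ?]] := join x y Hx Hy.
  by exists nu; case: (conv_subgroup_subring nu) => _ sub _; apply: sub.
have [nu [? ?]] := join x y Hx Hy.
by exists nu; case: (conv_subgroup_subring nu) => _ _ mul; apply: mul.
Qed.
HB.instance Definition _ :=
  GRing.isSubringClosed.Build R (conv_infty charkp) conv_infty_subring.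

Definition conv_infty_ring : Type := {x : R | x \in conv_infty charkp}.
HB.instance Definition _ := SubChoice.on conv_infty_ring.
HB.instance Definition _ := 
  GRing.SubChoice_isSubComPzRing.Build R (conv_infty charkp) conv_infty_ring
    conv_infty_subring.

End ConvolutionRing.

Section AlmostConstant.

Definition almost_constant : {pred nat -> rat} :=
  fun a => `[< exists i, forall j, (i <= j)%N -> a j = a i >].

Fact almost_constant_subring : subring_closed almost_constant.
Proof.
have join a b : a \in almost_constant -> b \in almost_constant ->
    exists i, forall j, (i <= j)%N -> a j = a i /\ b j = b i.
  move=> /asboolP[i Hi] /asboolP[j Hj]; exists (maxn i j) => l.
  rewrite geq_max => /andP[il jl].
  by rewrite !(Hi l, Hj l, Hi (maxn i j), Hj (maxn i j)) ?leq_maxl ?leq_maxr.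
split=> [|a b Ha Hb|a b Ha Hb]; apply/asboolP; first by exists 0%N.
  by have [i H] := join a b Ha Hb; exists i => j /H[aE bE]; rewrite !fctE aE bE.
by have [i H] := join a b Ha Hb; exists i => j /H[aE bE]; rewrite !fctE aE bE.
Qed.
HB.instance Definition _ :=
  GRing.isSubringClosed.Build (nat -> rat) almost_constant almost_constant_subring.

Definition almost_constant_ring : Type := {a : nat -> rat | a \in almost_constant}.
HB.instance Definition _ := SubChoice.on almost_constant_ring.
HB.instance Definition _ :=
  GRing.SubChoice_isSubComPzRing.Build (nat -> rat) almost_constant
    almost_constant_ring almost_constant_subring.

End AlmostConstant.

(* Main.v *)
From HB Require Import structures.
Require Import Defs.
From mathcomp Require Import all_boot all_algebra.
From mathcomp Require Import boolp functions.
From mathcomp Require Import freeg.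
From mathcomp Require Import zify ring.

Set Implicit Arguments.
Unset Strict Implicit.
Unset Printing Implicit Defensive.

Import GRing.Theory Num.Theory.

Local Open Scope ring_scope.

(* Rank of phi^n is additive on direct sums and invariant under isomorphism, so
   the number mu_n of Jordan blocks of size n, a second difference of these ranks,
   is an additive function on R; this avoids the Krull-Schmidt theorem.  As
   f_(p^i) f_(p^j) = p^i f_(p^j) for i <= j, the additive function
   chi_l = sum_(i <= l) p^i mu_(p^i), which maps f_(p^i) to p^i if i <= l and to 0
   otherwise, is multiplicative on R_infty.  The map x |-> (chi_l x)_l is the
   isomorphism after tensoring with Q: its inverse sends a to the sum over i of
   f_(p^i) (x) (a_i - a_(i-1)) / p^i, which is finite if a is almost constant. *)

(** * Maps out of presented rings and out of the tensor product *)

Section PresentedRingLift.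
Variables (P : ring_pres) (Z : zmodType) (f : P -> Z).
Hypothesis f_rel : forall r, rp_rel r -> fab_lift f r = 0.

(** The proof that [f] kills the relators is an argument, so that the morphism structure declared
    below can be attached to [pres_lift f_rel]. *)
Definition pres_lift of (forall r, rp_rel r -> fab_lift f r = 0) :=
  fun u : pres_ring P => fab_lift f (repr u).

(** The chosen representative differs from [x] by an element of the subgroup generated by the
    relators, on which [fab_lift f] vanishes. *)
Lemma pres_lift_pi x : pres_lift f_rel (pres_pi x) = fab_lift f x.
Proof.
have: generated (@rp_rel P) (repr (pres_pi x) - x).
  by apply/pres_piP; rewrite /pres_pi generic_quotient.reprK.
rewrite /pres_lift => gen; apply/eqP; rewrite -subr_eq0 -fab_liftB; apply/eqP.
elim: gen => [|y z _ Hy _ Hz|r]; first by rewrite raddf0.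
  by rewrite fab_liftB Hy Hz subr0.
exact: f_rel.
Qed.

Lemma pres_lift_gen a : pres_lift f_rel (pres_gen a) = f a.
Proof. by rewrite pres_lift_pi fab_liftU. Qed.

Lemma pres_liftB : {morph pres_lift f_rel : u v / u - v}.
Proof.
move=> u v; have [[x ->] [y ->]] := (pres_pi_surj u, pres_pi_surj v).
by rewrite -raddfB !pres_lift_pi fab_liftB.
Qed.
HB.instance Definition _ := GRing.isZmodMorphism.Build (pres_ring P) Z
  (pres_lift f_rel) pres_liftB.

End PresentedRingLift.

Lemma pres_lift_is_monoid_morphism (P : ring_pres) (Z : comPzRingType)
    (f : P -> Z) (f_rel : forall r, rp_rel r -> fab_lift f r = 0) :
    f (rp_one P) = 1 -> {morph f : a b / rp_mul a b >-> a * b} ->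
  monoid_morphism (pres_lift f_rel).
Proof.
move=> f1 fM; split=> [|u v]; first by rewrite -pres_gen1 pres_lift_gen.
elim/pres_ind: u => [|x y Hx Hy|a]; first by rewrite mul0r raddf0 mul0r.
  by rewrite mulrBl !pres_liftB mulrBl Hx Hy.
elim/pres_ind: v => [|x y Hx Hy|b]; first by rewrite mulr0 raddf0 mulr0.
  by rewrite mulrBr !pres_liftB mulrBr Hx Hy.
by rewrite -pres_genM !pres_lift_gen fM.
Qed.

Lemma tensor_ring_ind (A B : comPzRingType) (Q : tensor_ring A B -> Prop) :
  Q 0 -> (forall x y, Q x -> Q y -> Q (x - y)) ->
  (forall a b, Q (pure_tensor a b)) -> forall x, Q x.
Proof. by move=> Q0 QB QU; apply: pres_ind => // -[a b]; apply: QU. Qed.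

Lemma pure_tensorBl (A B : comPzRingType) (b : B) :
  {morph (fun a : A => pure_tensor a b) : x y / x - y}.
Proof. by move=> x y; apply/eqP; rewrite eq_sym subr_eq -pure_tensorDl subrK. Qed.

Lemma pure_tensorBr (A B : comPzRingType) (a : A) :
  {morph (fun b : B => pure_tensor a b) : x y / x - y}.
Proof. by move=> x y; apply/eqP; rewrite eq_sym subr_eq -pure_tensorDr subrK. Qed.

(** The map [(a, b) |-> g a * h b] is biadditive, hence kills the tensor relators, and is
    multiplicative because [C] is commutative. *)
Lemma tensor_ring_lift (A B C : comPzRingType)
    (g : {rmorphism A -> C}) (h : {rmorphism B -> C}) :
  exists phi : {rmorphism tensor_ring A B -> C},
    forall a b, phi (pure_tensor a b) = g a * h b.
Proof.
pose f (t : tens_pres A B) : C := g t.1 * h t.2.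
have f_rel r : rp_rel r -> fab_lift f r = 0.
  case=> [a a' b|a b b']; rewrite !fab_liftB !fab_liftU /f /= rmorphD; ring.
have f1 : f (rp_one _) = 1 by rewrite /f /= !rmorph1 mulr1.
have fM : {morph f : a b / rp_mul a b >-> a * b}.
  by move=> s t; rewrite /f /= !rmorphM mulrACA.
pose phiM := GRing.isMonoidMorphism.Build _ _ _
  (pres_lift_is_monoid_morphism f_rel f1 fM).
pose phi : {rmorphism tensor_ring A B -> C} := HB.pack (pres_lift f_rel) phiM.
by exists phi => a b; apply: pres_lift_gen.
Qed.


(** * Ranks of powers and the number of Jordan blocks of a given size *)

Section JordanMultiplicity.
Variable k : fieldType.
Implicit Types V W : nilmx k.

Lemma nil_isomX V W (f : 'M_(nil_dim W, nil_dim V)) n :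
  f *m nil_mx V = nil_mx W *m f -> f *m nil_mx V ^+ n = nil_mx W ^+ n *m f.
Proof.
move=> fV; elim: n => [|n IHn]; first by rewrite !expr0 mulmx1 mul1mx.
have -> : nil_mx V ^+ n.+1 = nil_mx V ^+ n *m nil_mx V by apply: exprSr.
have -> : nil_mx W ^+ n.+1 = nil_mx W ^+ n *m nil_mx W by apply: exprSr.
by rewrite mulmxA IHn -!mulmxA fV.
Qed.

Lemma rank_nil_isom V W n :
  nil_isom V W -> \rank (nil_mx V ^+ n) = \rank (nil_mx W ^+ n).
Proof.
have le V' W' : nil_isom V' W' ->
    (\rank (nil_mx V' ^+ n) <= \rank (nil_mx W' ^+ n))%N.
  (* The n-th power for [V'] equals [g] times the n-th power for [W'] times [f], which bounds its
     rank. *)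
  move=> [f [g [gf _ fV]]]; rewrite -[nil_mx V' ^+ n]mul1mx -gf -mulmxA.
  rewrite nil_isomX //; apply: leq_trans (mxrankM_maxr _ _) _.
  exact: mxrankM_maxl.
by move=> VW; apply/eqP; rewrite eqn_leq !le //; apply: nil_isom_sym.
Qed.

Lemma rank_dsumX V W n :
  \rank (nil_mx (dsum V W) ^+ n) =
    (\rank (nil_mx V ^+ n) + \rank (nil_mx W ^+ n))%N.
Proof.
rewrite -rank_diag_block_mx; congr (\rank _).
elim: n => [|n IHn]; first by rewrite !expr0 -scalar_mx_block.
rewrite !exprS IHn -[LHS]/(_ *m _) mulmx_block.
by rewrite !mul0mx !mulmx0 !addr0 add0r.
Qed.

Lemma rank_jordanX s n : \rank (jordan k s ^+ n) = (s - n)%N.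
Proof.
rewrite jordanX; have [lt_sn|le_ns] := ltnP s n.
  rewrite (_ : \matrix_(_, _) _ = 0) ?mxrank0; first by apply/esym/eqP; lia.
  by apply/matrixP=> i j; rewrite !mxE; case: eqP => //; have := ltn_ord j; lia.
(* The power factors through dimension [s - n] as [L *m C]. Since [L^T] is a left inverse of [L] and
   [C^T] a right inverse of [C], the rank is exactly [s - n]. *)
pose L : 'M[k]_(s, s - n) := \matrix_(i, a) (i == a :> nat)%:R.
pose C : 'M[k]_(s - n, s) := \matrix_(a, j) ((a + n)%N == j)%:R.
have lt_a (a : 'I_(s - n)) : (a < s)%N by have := ltn_ord a; lia.
have lt_an (a : 'I_(s - n)) : (a + n < s)%N by have := ltn_ord a; lia.
have -> : \matrix_(i < s, j < s) ((i + n)%N == j)%:R = L *m C.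
  apply/matrixP=> i j; rewrite !mxE.
  have [lt_is|le_si] := ltnP i (s - n); last first.
    rewrite big1 => [|a _]; last first.
      by rewrite !mxE gtn_eqF ?mul0r //; have := ltn_ord a; lia.
    by rewrite gtn_eqF //; have := ltn_ord j; lia.
  rewrite (bigD1 (Ordinal lt_is)) //= !mxE eqxx mul1r big1 ?addr0 // => a ne.
  by rewrite !mxE eq_sym (negbTE (ne : val a != val (Ordinal lt_is))) mul0r.
have LL : L^T *m L = 1%:M.
  apply/matrixP=> a b; rewrite !mxE (bigD1 (Ordinal (lt_a a))) //= !mxE eqxx mul1r.
  rewrite big1 ?addr0 // => i ne.
  by rewrite !mxE (negbTE (ne : val i != val (Ordinal (lt_a a)))) mul0r.
have CC : C *m C^T = 1%:M.
  apply/matrixP=> a b; rewrite !mxE (bigD1 (Ordinal (lt_an a))) //= !mxE eqxx mul1r.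
  rewrite big1 ?addr0 ?eqn_add2r 1?eq_sym // => i ne.
  by rewrite !mxE eq_sym (negbTE (ne : val i != val (Ordinal (lt_an a)))) mul0r.
apply/eqP; rewrite eqn_leq (leq_trans (mxrankM_maxl _ _) (rank_leq_col _)) /=.
rewrite -{1}(mxrank1 k (s - n)) -{1}LL -[L in L^T *m L]mulmx1 -CC !mulmxA.
rewrite -2!mulmxA [_ *m (C *m _)]mulmxA.
by apply: leq_trans (mxrankM_maxr _ _) (mxrankM_maxl _ _).
Qed.

(* The number of Jordan blocks of size n.+1 of V, since the rank of J_s^n is the
   truncated difference s - n. *)
Definition block_count n V : int :=
  (\rank (nil_mx V ^+ n))%:Z - (\rank (nil_mx V ^+ n.+1))%:Z *+ 2
  + (\rank (nil_mx V ^+ n.+2))%:Z.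

Definition isoclass_block_count n (c : conv_pres k) : int :=
  block_count n (generic_quotient.repr (c : isoclass k)).

Lemma isoclass_block_countE n V : isoclass_block_count n (cls V) = block_count n V.
Proof.
have VV : nil_isom (generic_quotient.repr (cls V)) V.
  by apply/cls_eq; rewrite cls_repr.
by rewrite /isoclass_block_count /block_count !(rank_nil_isom _ VV).
Qed.

Fact isoclass_block_count_rel n (r : {freeg conv_pres k}) :
  rp_rel r -> fab_lift (isoclass_block_count n) r = 0.
Proof.
case=> V V' V'' VV; rewrite !fab_liftB !fab_liftU !isoclass_block_countE.
rewrite /block_count !(rank_nil_isom _ VV) !rank_dsumX !PoszD; ring.
Qed.

Definition mult n : conv_ring k -> int :=
  pres_lift (@isoclass_block_count_rel n).
HB.instance Definition _ n := GRing.Additive.on (mult n).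

Lemma mult_jordan n s : mult n (jordan_cls k s) = (s == n.+1)%:R.
Proof.
rewrite /mult /jordan_cls /conv_cls pres_lift_gen isoclass_block_countE.
rewrite /block_count /= !rank_jordanX; lia.
Qed.

End JordanMultiplicity.


(** * The characters [conv_char l] of R_infty *)

Section Characters.
Variables (k : fieldType) (p : nat).
Hypothesis charkp : p \in [pchar k].
Local Notation Rinfty := (conv_infty_ring charkp).

(** The predecessor compensates for [mult n] counting blocks of size [n.+1]. *)
Definition pmult i : conv_ring k -> int := mult (p ^ i).-1.
HB.instance Definition _ i := GRing.Additive.on (pmult i).

Lemma pmult_jordan i j : pmult i (jordan_cls k (p ^ j)) = (i == j)%:R.
Proof.
have p_gt1 := prime_gt1 (pcharf_prime charkp).
rewrite /pmult mult_jordan prednK ?expn_gt0 ?(ltnW p_gt1) //.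
by rewrite eqn_exp2l // eq_sym.
Qed.

Lemma conv_infty_ind (Q : Rinfty -> Prop) :
  Q 0 -> (forall x y, Q x -> Q y -> Q (x - y)) ->
  (forall x i, \val x = jordan_cls k (p ^ i) -> Q x) -> forall x, Q x.
Proof.
move=> Q0 QB QJ x; have /asboolP[nu /gen_subgroupP gen] := valP x.
(* The generation proof runs in the whole ring R; its intermediate elements are brought back into
   R_infty, where [Q] is defined. *)
have lift y :
    generated (fun z => exists2 i, (i <= nu)%N & z = jordan_cls k (p ^ i)) y ->
    exists Y : Rinfty, \val Y = y.
  move=> /gen_subgroupP y_in.
  have Ry : y \in conv_infty charkp by apply/asboolP; exists nu.
  by exists (Sub y Ry); rewrite SubK.
move E: (\val x) gen => y gen; elim: gen x E => {y} [|y z gy Qy gz Qz|_ [i _ ->]] x xE.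
- by have -> : x = 0 by apply: val_inj; rewrite xE raddf0.
- have [[Y YE] [Z ZE]] := (lift y gy, lift z gz).
  have -> : x = Y - Z by apply: val_inj; rewrite xE raddfB -YE -ZE.
  by apply: QB; [apply: Qy|apply: Qz].
exact: QJ xE.
Qed.

Definition conv_char (l : nat) (x : Rinfty) : int :=
  \sum_(i < l.+1) (p ^ i)%:Z * pmult i (\val x).

Lemma conv_charB l : {morph conv_char l : x y / x - y}.
Proof.
by move=> x y; rewrite /conv_char -sumrB; apply: eq_bigr => i _; rewrite !raddfB mulrBr.
Qed.

HB.instance Definition _ l :=
  GRing.isZmodMorphism.Build Rinfty int (conv_char l) (@conv_charB l).

Lemma conv_char0 l : conv_char l 0 = 0.
Proof. exact: raddf0. Qed.

Lemma conv_char_jordan l i (x : Rinfty) : \val x = jordan_cls k (p ^ i) ->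
  conv_char l x = if (i <= l)%N then (p ^ i)%:Z else 0.
Proof.
move=> xE; rewrite /conv_char xE; under eq_bigr do rewrite pmult_jordan.
case: leqP => [le_il|lt_li]; last first.
  by apply: big1 => j _; rewrite ltn_eqF ?mulr0 //; have := ltn_ord j; lia.
rewrite (bigD1 (Ordinal (le_il : (i < l.+1)%N))) //= eqxx mulr1 big1 ?addr0 // => j ne.
by rewrite (negbTE (ne : val j != i)) mulr0.
Qed.

Lemma conv_char1 l : conv_char l 1 = 1.
Proof. by rewrite (@conv_char_jordan l 0) ?expn0 ?jordan_cls1 ?rmorph1. Qed.

(** By biadditivity and symmetry, [x] and [y] may be taken to be f_(p^i) and f_(p^j) with [i <= j],
    whose product is p^i [y]. *)
Lemma conv_charM l : {morph conv_char l : x y / x * y}.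
Proof.
move=> x y; elim/conv_infty_ind: x => [|u v Hu Hv|x i xE].
- by rewrite mul0r conv_char0 mul0r.
- by rewrite mulrBl !conv_charB Hu Hv mulrBl.
elim/conv_infty_ind: y => [|u v Hu Hv|y j yE].
- by rewrite mulr0 conv_char0 mulr0.
- by rewrite mulrBr !conv_charB Hu Hv mulrBr.
wlog le_ij: x y i j xE yE / (i <= j)%N => [W|].
  have [/W-> //|/ltnW le_ji] := leqP i j.
  by rewrite mulrC [RHS]mulrC (W y x j i).
have -> : x * y = y *+ (p ^ i).
  apply: val_inj; transitivity (\val x * \val y); first exact: rmorphM.
  by rewrite xE yE jordan_clsM // -yE [RHS]raddfMn.
have -> : conv_char l (y *+ (p ^ i)) = conv_char l y *+ (p ^ i).
  exact: raddfMn.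
rewrite (conv_char_jordan l xE) (conv_char_jordan l yE).
(* If [l < j], then [y] has value 0 and both sides vanish; otherwise [i <= j <= l], so [x] has value
   p^i. *)
case: leqP => [le_jl|_]; last by rewrite mulr0 mul0rn.
by rewrite (leq_trans le_ij le_jl) -mulr_natl natz.
Qed.

Lemma conv_char_almost_constant x :
  (fun l => (conv_char l x)%:~R : rat) \in almost_constant.
Proof.
apply/asboolP; elim/conv_infty_ind: x => [|x y [i Hi] [j Hj]|x i xE].
- by exists 0%N => l _; rewrite !conv_char0.
- exists (maxn i j) => l; rewrite geq_max => /andP[il jl].
  rewrite !conv_charB !rmorphB /= (Hi _ il) (Hj _ jl).
  by rewrite (Hi (maxn i j)) ?leq_maxl // (Hj (maxn i j)) ?leq_maxr.
by exists i => l il; rewrite !(conv_char_jordan _ xE) il leqnn.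
Qed.

Definition conv_chars (x : Rinfty) : almost_constant_ring :=
  
  Sub (fun l => (conv_char l x)%:~R) (conv_char_almost_constant x).

Fact conv_chars_is_zmod_morphism : zmod_morphism conv_chars.
Proof.
move=> x y; apply: val_inj; rewrite rmorphB /=; apply/funext => l.
by rewrite conv_charB rmorphB.
Qed.
HB.instance Definition _ := GRing.isZmodMorphism.Build Rinfty
  almost_constant_ring conv_chars conv_chars_is_zmod_morphism.

Fact conv_chars_is_monoid_morphism : monoid_morphism conv_chars.
Proof.
split=> [|x y]; apply: val_inj; rewrite ?rmorph1 ?rmorphM /=; apply/funext => l.
  by rewrite conv_char1.
by rewrite conv_charM rmorphM.
Qed.
HB.instance Definition _ := GRing.isMonoidMorphism.Build Rinfty
  almost_constant_ring conv_chars conv_chars_is_monoid_morphism.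


Fact jordan_in_conv_infty i : jordan_cls k (p ^ i) \in conv_infty charkp.
Proof.
apply/asboolP; exists i; apply/gen_subgroupP/generated_mem.
by exists i.
Qed.

Definition jordan_infty i : Rinfty :=
  Sub (jordan_cls k (p ^ i)) (jordan_in_conv_infty i).

End Characters.

(** * Constant sequences and successive differences *)

Fact cst_almost_constant (q : rat) : (fun=> q : rat) \in almost_constant.
Proof. by apply/asboolP; exists 0%N. Qed.

Definition cst_seq (q : rat) : almost_constant_ring :=
  Sub (fun=> q) (cst_almost_constant q).

Fact cst_seq_is_zmod_morphism : zmod_morphism cst_seq.
Proof. by move=> q r; apply: val_inj; rewrite raddfB. Qed.
HB.instance Definition _ := GRing.isZmodMorphism.Build rat almost_constant_ring
  cst_seq cst_seq_is_zmod_morphism.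

Fact cst_seq_is_monoid_morphism : monoid_morphism cst_seq.
Proof. by split=> [|q r]; apply: val_inj; rewrite ?rmorph1 ?rmorphM. Qed.
HB.instance Definition _ := GRing.isMonoidMorphism.Build rat almost_constant_ring
  cst_seq cst_seq_is_monoid_morphism.

(** Successive differences, with the convention that the term of index -1 is 0. *)
Definition seq_diff (Z : zmodType) (a : nat -> Z) (i : nat) : Z :=
  if i is j.+1 then a i - a j else a 0%N.

Lemma sum_seq_diff (Z : zmodType) (a : nat -> Z) n :
  \sum_(i < n.+1) seq_diff a i = a n.
Proof.
elim: n => [|n IHn]; first by rewrite big_ord1.
by rewrite big_ord_recr IHn /= addrC subrK.
Qed.

Lemma seq_diffB (Z : zmodType) (a b : nat -> Z) i :
  seq_diff (fun l => a l - b l) i = seq_diff a i - seq_diff b i.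
Proof. by case: i => [|i] //=; rewrite !opprD !opprK addrACA. Qed.

(** With c = p^i q, the step sequence is the image of f_(p^i) (x) q, which its single nonzero
    difference recovers. *)
Lemma seq_diff_step (Z : zmodType) (c : Z) i j :
  seq_diff (fun l => if (i <= l)%N then c else 0) j = if j == i then c else 0.
Proof.
case: j => [|j] /=; first by rewrite leqn0 eq_sym.
have [<-|ne] := eqVneq j.+1 i; first by rewrite leqnn ltnn subr0.
by rewrite (leq_eqVlt i) eq_sym (negbTE ne) ltnS; case: ifP; rewrite subrr.
Qed.

(** * Bijectivity of the map into almost constant sequences *)

Section Isomorphism.
Variables (k : fieldType) (p : nat).
Hypothesis charkp : p \in [pchar k].
Local Notation Rinfty := (conv_infty_ring charkp).
Local Notation RinftyQ := (tensor_ring Rinfty rat).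

(** The inverse map cut off after [n] terms. Fixing [n] independently of [a] makes it additive in
    [a]. *)
Definition conv_seq (n : nat) (a : nat -> rat) : RinftyQ :=
  \sum_(i < n) pure_tensor (jordan_infty charkp i) (seq_diff a i / (p ^ i)%:R).

Lemma conv_seqB n (a b : nat -> rat) :
  conv_seq n (fun l => a l - b l) = conv_seq n a - conv_seq n b.
Proof.
rewrite /conv_seq -sumrB; apply: eq_bigr => i _.
by rewrite seq_diffB mulrBl pure_tensorBr.
Qed.

Lemma pnat_neq0 i : (p ^ i)%:R != 0 :> rat.
Proof.
by rewrite pnatr_eq0 expn_eq0 -leqn0 leqNgt prime_gt0 ?(pcharf_prime charkp).
Qed.

Variable phi : {rmorphism RinftyQ -> almost_constant_ring}.
Hypothesis phiE : forall x q, phi (pure_tensor x q) = conv_chars x * cst_seq q.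

Lemma phi_pure x q l : \val (phi (pure_tensor x q)) l = (conv_char l x)%:~R * q.
Proof. by rewrite phiE. Qed.

(** This gives injectivity: [t] is recovered from [phi t] by a long enough sum. The property passes
    to differences by taking the maximum of the bounds, which reduces it to f_(p^i) (x) q. *)
Lemma eventually_conv_seq_phi t :
  exists N, forall n, (N <= n)%N -> conv_seq n (\val (phi t)) = t.
Proof.
have conv_seq_phiB n t1 t2 : conv_seq n (\val (phi (t1 - t2))) =
    conv_seq n (\val (phi t1)) - conv_seq n (\val (phi t2)).
  by rewrite -conv_seqB rmorphB.
have step t1 t2 :
    (exists N, forall n, (N <= n)%N -> conv_seq n (\val (phi t1)) = t1) ->
    (exists N, forall n, (N <= n)%N -> conv_seq n (\val (phi t2)) = t2) ->
    exists N, forall n, (N <= n)%N -> conv_seq n (\val (phi (t1 - t2))) = t1 - t2.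
  move=> [N1 H1] [N2 H2]; exists (maxn N1 N2) => n; rewrite geq_max => /andP[le1 le2].
  by rewrite conv_seq_phiB H1 ?H2.
have zero : exists N, forall n, (N <= n)%N -> conv_seq n (\val (phi 0)) = 0.
  by exists 0%N => n _; have := conv_seq_phiB n 0 0; rewrite !subrr.
elim/tensor_ring_ind: t => // x q.
elim/conv_infty_ind: x => [|x y Hx Hy|x i xE].
- by have := pure_tensorBl q (0 : Rinfty) 0; rewrite /= !subrr => ->.
- by rewrite pure_tensorBl; apply: step.
have -> : x = jordan_infty charkp i by apply: val_inj.
(* The sum must reach the index [i], the only one at which the image jumps. *)
exists i.+1 => n lt_in.
have -> : \val (phi (pure_tensor (jordan_infty charkp i) q)) =
    (fun l => if (i <= l)%N then (p ^ i)%:R * q else 0).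
  apply/funext => l; rewrite phi_pure (@conv_char_jordan _ _ _ _ i) //.
  by case: leqP; rewrite ?mul0r.
rewrite /conv_seq; under eq_bigr do rewrite seq_diff_step.
rewrite (bigD1 (Ordinal lt_in)) //= eqxx mulrAC divff ?pnat_neq0 // mul1r.
rewrite big1 ?addr0 // => j ne; rewrite (negbTE (ne : val j != i)) mul0r.
by have := pure_tensorBr (jordan_infty charkp j) (0 : rat) 0; rewrite /= !subrr.
Qed.

Lemma phi_surjective (a : almost_constant_ring) : exists t, phi t = a.
Proof.
have /asboolP[N aN] := valP a; exists (conv_seq N.+1 (\val a)).
apply: val_inj; apply/funext => l; rewrite -[LHS]/(\val _ l).
(* The character [l] sends f_(p^i) to p^i if [i <= l], cancelling the denominator, and to 0
   otherwise. *)
transitivity (\sum_(i < N.+1 | (i < l.+1)%N) seq_diff (\val a) i).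
  rewrite (big_morph (fun t => \val (phi t) l) (id1 := 0) (op1 := +%R)) => [|t u|].
  - rewrite [RHS]big_mkcond; apply: eq_bigr => i _.
    rewrite phi_pure (@conv_char_jordan _ _ _ _ i) // ltnS.
    by case: leqP; rewrite ?mul0r // mulrC divfK ?pnat_neq0.
  - by rewrite rmorphD.
  by rewrite rmorph0.
(* The sum telescopes to the term of index min(l, N), which is [a l] because [a] is constant from
   [N] on. *)
have [le_lN|lt_Nl] := leqP l N.
  by rewrite -big_ord_widen // sum_seq_diff.
rewrite (aN l (ltnW lt_Nl)) -(sum_seq_diff (\val a) N); apply: eq_bigl => i.
by have := ltn_ord i; lia.
Qed.

End Isomorphism.

Theorem proposition5p2 (p : nat) (p_prime : prime p) (k : fieldType)
    (charkp : p \in [pchar k]) :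
  exists phi : {rmorphism tensor_ring (conv_infty_ring charkp) rat ->
                          almost_constant_ring},
    bijective phi.
Proof.
have [phi phiE] := tensor_ring_lift
  (conv_chars (charkp := charkp) : {rmorphism _ -> _}) (cst_seq : {rmorphism _ -> _}).
have [psi psiK] := choice (phi_surjective phiE).
exists phi; exists psi => // t.
(* Both [t] and [psi (phi t)] have image [phi t]; past both bounds, each equals [conv_seq] of that
   image, so they coincide. *)
have [N1 H1] := eventually_conv_seq_phi phiE t.
have [N2 H2] := eventually_conv_seq_phi phiE (psi (phi t)).
rewrite -[RHS](H1 (maxn N1 N2)) ?leq_maxl //.
by rewrite -[LHS](H2 (maxn N1 N2)) ?leq_maxr // psiK.
Qed.
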